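(* Let $G$ be any (finite or infinite) group with identity $\mathbf{1}$. Then every colour-permuting automorphism of the complete Cayley graph $\mathrm{Cay}(G; G\setminus\{\mathbf{1}\})$ is the composition of a group automorphism of $G$ and a colour-preserving graph automorphism of $\mathrm{Cay}(G; G\setminus\{\mathbf{1}\})$.
   Context: For an inverse-closed subset $S$ of a group $G$, the Cayley graph $\mathrm{Cay}(G;S)$ has vertex set $G$ and an edge from $g$ to $gs$ for each $g\in G$, $s\in S$; the edge $g$—$gs$ is coloured with the set $\{s,s^{-1}\}$. A graph automorphism is colour-preserving if it maps every edge to an edge of the same colour, and colour-permuting if whenever two edges have the same colour their images also have the same colour. *)

(* Defs.v *)
Record group_law (G : Type) := GroupLaw {
  gmul : G -> G -> G;
  gone : G;
  ginv : G -> G;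
  gmulA : forall x y z, gmul x (gmul y z) = gmul (gmul x y) z;
  gmul1 : forall x, gmul gone x = x;
  gmulV : forall x, gmul (ginv x) x = gone
}.

Arguments gmul {G} _ _ _.
Arguments gone {G} _.
Arguments ginv {G} _ _.

Section Cayley.
Context {G : Type} (Gr : group_law G).

Definition bijective_map (f : G -> G) : Prop :=
  exists g : G -> G, (forall x, g (f x) = x) /\ (forall y, f (g y) = y).

Definition conn_set (s : G) : Prop := s <> gone Gr.

Definition cay_adj (g h : G) : Prop :=
  exists s, conn_set s /\ h = gmul Gr g s.

(* The colour of the edge g -- h (with h = g s) is the set {s, s^-1}. *)
Definition colour (g h : G) : G -> Prop :=
  fun t => t = gmul Gr (ginv Gr g) h \/ t = gmul Gr (ginv Gr h) g.

Definition same_colour (g h g' h' : G) : Prop :=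
  forall t, colour g h t <-> colour g' h' t.

Definition graph_aut (f : G -> G) : Prop :=
  bijective_map f /\ forall g h, cay_adj g h <-> cay_adj (f g) (f h).

Definition colour_preserving (f : G -> G) : Prop :=
  graph_aut f /\
  forall g h, cay_adj g h -> same_colour (f g) (f h) g h.

Definition colour_permuting (f : G -> G) : Prop :=
  graph_aut f /\
  forall g h g' h', cay_adj g h -> cay_adj g' h' ->
    same_colour g h g' h' -> same_colour (f g) (f h) (f g') (f h').

Definition group_aut (a : G -> G) : Prop :=
  bijective_map a /\ forall x y, a (gmul Gr x y) = gmul Gr (a x) (a y).

End Cayley.

(* Main.v *)
(** After a left translation we may assume that phi fixes 1, so that
    phi(xs) is phi(x)phi(s) or phi(x)phi(s)^-1. Transporting the group law along
    phi gives a second law # on the same set, isomorphic to the first, with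
    x # y equal to xy or xy^-1; we show that # is the given law or its opposite.

    If # has the same involutions as the given law, then x # y <> xy forces x and y to
    generate a quaternion group in which x # y = yx, and an argument in the style
    of Scott's theorem on half-homomorphisms applies.

    Otherwise some u has u # u = 1 and uu <> 1. If x # y <> xy for some x and y,
    all involutions of the given law are central, hence, by the isomorphism, so are those of #.
    Elements commuting with u are then involutions for #, and all elements that
    are not involutions for # invert u, which makes # commutative. Then both
    laws have exponent 2, contradicting uu <> 1. *)
From Stdlib Require Import Classical.
Require Import Defs.

(** * Elementary group identities and cancellation tactics *)

Section Group.
Context {G : Type} (Gr : group_law G).
Local Notation "x * y" := (gmul Gr x y).
Local Notation "x ^-" := (ginv Gr x) (at level 3, format "x ^-").
Local Notation "1" := (gone Gr).

Lemma gmulKV x y : x^- * (x * y) = y.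
Proof. now rewrite gmulA, gmulV, gmul1. Qed.

Lemma gmul_cancel_l x y z : x * y = x * z -> y = z.
Proof. intro E. now rewrite <- (gmulKV x y), E, gmulKV. Qed.

Lemma gmulVr x : x * x^- = 1.
Proof. apply (gmul_cancel_l (x^-)). rewrite gmulKV. apply (gmul_cancel_l (x^-^-)).
  now rewrite gmulKV, gmulV. Qed.

Lemma gmul1r x : x * 1 = x.
Proof. now rewrite <- (gmulV _ Gr x), gmulA, gmulVr, gmul1. Qed.

Lemma gmulK x y : x * (x^- * y) = y.
Proof. now rewrite gmulA, gmulVr, gmul1. Qed.

Lemma ginvK x : x^-^- = x.
Proof. apply (gmul_cancel_l (x^-)). now rewrite gmulVr, gmulV. Qed.

Lemma ginvM x y : (x * y)^- = y^- * x^-.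
Proof.
  apply (gmul_cancel_l (x * y)).
  now rewrite gmulVr, <- gmulA, gmulK, gmulVr.
Qed.

Lemma ginv1 : 1^- = 1.
Proof. now rewrite <- (gmul1r (1^-)), gmulV. Qed.

Lemma gmulAr x y z : (x * y) * z = x * (y * z).
Proof. symmetry; apply gmulA. Qed.

Lemma ginv_uniq x y : x * y = 1 -> y = x^-.
Proof. intro E. apply (gmul_cancel_l x). now rewrite E, gmulVr. Qed.
End Group.

Ltac grp_simpl_in H :=
  repeat rewrite ?gmulAr, ?ginvM, ?ginvK, ?ginv1, ?gmulV, ?gmulVr, ?gmulKV,
    ?gmulK, ?gmul1, ?gmul1r in H.
Ltac grp_simpl :=
  repeat rewrite ?gmulAr, ?ginvM, ?ginvK, ?ginv1, ?gmulV, ?gmulVr, ?gmulKV,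
    ?gmulK, ?gmul1, ?gmul1r.
Tactic Notation "grp_from" constr(Gr) constr(E) constr(a) constr(b) :=
  let F := fresh in
  pose proof (f_equal (fun t => gmul Gr (gmul Gr a t) b) E) as F; cbv beta in F;
  grp_simpl_in F; grp_simpl; congruence.

(** * Two group laws that agree up to inverting the right factor *)

Section TwoLaws.
Context {G : Type} (D S : group_law G).
Local Notation "x * y" := (gmul D x y).
Local Notation "x # y" := (gmul S x y) (at level 40, left associativity).
Local Notation "x ^-" := (ginv D x) (at level 3, format "x ^-").
Local Notation "1" := (gone D).
Hypothesis same_one : gone S = 1.
Hypothesis star_dot : forall x y, x # y = x * y \/ x # y = x * y^-.

Lemma star_1l x : 1 # x = x.
Proof. rewrite <- same_one. apply gmul1. Qed.

Lemma star_invol x w : w * w = 1 -> x # w = x * w.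
Proof.
  intro E. apply ginv_uniq in E. destruct (star_dot x w); congruence.
Qed.

(** Otherwise [x # y^-] equals [x # y], so [y^- = y] and the two alternatives coincide. *)
Lemma star_other x y : x # y = x * y -> x # y^- = x * y^-.
Proof.
  intro E. destruct (star_dot x (y^-)) as [F|F]; [exact F|].
  rewrite ginvK, <- E in F. apply gmul_cancel_l in F. now rewrite F.
Qed.

Lemma star_reach x y : x # y = x * y \/ x # y^- = x * y.
Proof.
  destruct (star_dot x (y^-)) as [E|E]; rewrite ?ginvK in E; [left|now right].
  apply star_other in E. now rewrite ginvK in E.
Qed.

Lemma star_sq_invol x : x * x = 1 -> x # x = 1.
Proof. intro E. now rewrite star_invol. Qed.

Lemma star_inv_cases x : ginv S x = x^- \/ x # x = 1.
Proof.
  pose proof (gmulVr S x) as E. rewrite same_one in E.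
  destruct (star_dot x (ginv S x)) as [F|F]; rewrite E in F; symmetry in F;
    apply ginv_uniq in F.
  - now left.
  - right. assert (ginv S x = x) as F' by (rewrite <- (ginvK D (ginv S x)), F; apply ginvK).
    now rewrite F' in E.
Qed.

(** If [x # k = x * k^-], then [x # (k * w) = (x # k) # w = x * k^- * w]. This must be [x * k * w],
    so that [k^- = k], or [x * w * k^-], so that [k] commutes with [w]. *)
Lemma noncomm_rigid w k x :
  w * w = 1 -> k * w <> w * k -> x # k = x * k.
Proof.
  intros W N. destruct (star_dot x k) as [E|E]; [exact E|].
  assert (x # (k * w) = x * k^- * w) as F.
  { rewrite <- (star_invol k w W), gmulA, E. now apply star_invol. }
  assert (w^- = w) as W' by (symmetry; now apply ginv_uniq).
  destruct (star_dot x (k * w)) as [F'|F']; rewrite F in F'.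
  - rewrite E. grp_from D F' 1 (w^-).
  - exfalso. apply N. rewrite ginvM, W', gmulAr in F'. apply gmul_cancel_l in F'.
    grp_from D F' k k.
Qed.

(* The elements [k] with [z # k = z * k] for all [z] form a subgroup, which contains
   the complement of the centraliser of [w] by [noncomm_rigid]; a proper
   subgroup has a complement that generates the whole group. *)
Lemma invol_central w k x y :
  x # y <> x * y -> w * w = 1 -> k * w = w * k.
Proof.
  intros N W. apply NNPP. intro C. apply N.
  pose proof (fun z => noncomm_rigid w k z W C) as R.
  assert (y * w = w * y) as Cy.
  { apply NNPP. intro Cy. apply N. now apply (noncomm_rigid w). }
  assert (y * k * w <> w * (y * k)) as Cyk.
  { intro E. apply C. apply (gmul_cancel_l D y).
    rewrite !gmulA, E, Cy. now rewrite gmulA. }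
  pose proof (noncomm_rigid w (y * k) x W Cyk) as E.
  rewrite <- (R y), gmulA, !R in E. grp_from D E 1 (k^-).
Qed.

(** * Laws with the same involutions *)

Section NoMerging.
Hypothesis no_merge : forall x, x # x = 1 -> x * x = 1.

Lemma star_inv x : ginv S x = x^-.
Proof.
  destruct (star_inv_cases x) as [E|E]; [exact E|].
  transitivity x.
  - symmetry. apply ginv_uniq. now rewrite same_one.
  - apply ginv_uniq. now apply no_merge.
Qed.

(** Both laws have the same inverses here, so the inverse of [x # y] is [y^- # x^-]. This forces
    [x * y^- = x^- * y]. *)
Lemma star_neq_sq x y : x # y <> x * y -> x # y = x * y^- /\ x * x = y * y.
Proof.
  intro N. destruct (star_dot x y) as [E|E]; [contradiction|]. split; [exact E|].
  pose proof (ginvM S x y) as I. rewrite !star_inv in I.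
  destruct (star_dot (y^-) (x^-)) as [F|F]; rewrite F in I; apply (f_equal (ginv D)) in I;
    grp_simpl_in I.
  - contradiction.
  - rewrite E in I. grp_from D I x y.
Qed.

Lemma star_sq x : x # x = x * x.
Proof.
  destruct (star_dot x x) as [E|E]; [exact E|].
  rewrite gmulVr in E. now rewrite E, no_merge.
Qed.

Lemma star_neq_quaternion x y : x # y <> x * y ->
  x # y = y * x /\ y * x = x * y^- /\ y * y * (y * y) = 1 /\ y * y <> 1.
Proof.
  intro N. destruct (star_neq_sq x y N) as [E Q].
  assert (y * y <> 1) as Y.
  { intro Y. apply N. now apply star_invol. }
  assert (x * x # y = y * y * y) as E2.
  { rewrite <- Q. apply NNPP. intro N2. apply star_neq_sq in N2 as [_ Q2].
    apply Y. rewrite <- Q in Q2. rewrite <- Q. grp_from D Q2 (x^-) (x^-). }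
  (* Rebracketing [(x # x) # y] as [x # (x # y)] computes the conjugate of [y] by [x]. *)
  rewrite <- star_sq, gmulAr, E in E2.
  assert (x * y * x^- = y * y * y) as C.
  { destruct (star_dot x (x * y^-)) as [F|F]; rewrite E2 in F.
    - exfalso. apply Y. rewrite gmulA, Q in F. grp_from D F 1 (y^-).
    - rewrite F. now grp_simpl. }
  (* Conjugation by [x] cubes [y] but fixes [y * y = x * x], so the sixth power of [y] equals its
     square. *)
  assert (y * y * (y * y) = 1) as Y4.
  { assert (x * (y * y) * x^- = y * y) as F by (rewrite <- Q; now grp_simpl).
    assert (x * y * x^- * (x * y * x^-) = y * y) as F' by (rewrite <- F at 1; now grp_simpl).
    rewrite C in F'. grp_from D F' 1 (y^- * y^-). }
  assert (y * x = x * y^-) as K.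
  { assert (x * y * x^- = y^-) as C'.
    { rewrite C. apply ginv_uniq. rewrite <- Y4. now grp_simpl. }
    grp_from D C' y (x * y^-). }
  repeat split; congruence.
Qed.

(* Compare the two ways of bracketing [b # y # a]. *)
Lemma half_hom_assoc a b y :
  y # a = y * a -> y * a <> a * y -> b # y = y * b -> y * b <> b * y ->
  b * y * a = a * y * b \/ a * b = b * a.
Proof.
  intros A NA B NB.
  assert (forall p q, p # q = p * q \/ p # q = q * p) as HH.
  { intros p q. destruct (classic (p # q = p * q)) as [E|E]; [now left|right].
    now apply star_neq_quaternion. }
  pose proof (gmulA _ S b y a) as E. rewrite A, B in E.
  destruct (HH b (y * a)) as [F|F], (HH (y * b) a) as [F'|F']; rewrite F, F' in E.
  - exfalso. apply NB. grp_from D E 1 (a^-).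
  - left. now rewrite <- gmulA, E, gmulA.
  - right. rewrite !gmulAr in E. now apply gmul_cancel_l in E.
  - exfalso. apply NA. rewrite gmulA in E. grp_from D E 1 (b^-).
Qed.

(** If both sides fail, [half_hom_assoc] applies to [a] and also to [y * a]; the resulting relations
    are incompatible with the quaternion relations between [b] and [y]. *)
Lemma half_hom_sides y a b : y # a = a * y \/ b # y = b * y.
Proof.
  destruct (classic (b # y = b * y)) as [E|NB]; [now right|left].
  destruct (star_neq_quaternion b y NB) as (B & K & Y4 & Y2).
  apply NNPP. intro NA.
  assert (y # a = y * a) as A.
  { apply NNPP. intro E. now apply star_neq_quaternion in E as []. }
  assert (y * a <> a * y) as NA' by congruence.
  assert (y * b <> b * y) as NB' by congruence.
  assert (y # (y * a) = y * (y * a)) as A2.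
  { assert ((y * y) # a = y * y * a) as F.
    { apply NNPP. intro E. apply star_neq_sq in E as E'. destruct E' as [_ E'].
      apply star_neq_quaternion in E as (_ & _ & _ & E). congruence. }
    now rewrite <- A, gmulA, star_sq, F, A, gmulA. }
  assert (y * (y * a) <> y * a * y) as NA2.
  { intro E. rewrite gmulAr in E. now apply gmul_cancel_l in E. }
  assert (y * b * y = b) as K' by (rewrite K; now grp_simpl).
  (* Each of the four combinations makes [y * y] trivial or makes [y] commute with [a] or with
     [b]. *)
  destruct (half_hom_assoc a b y A NA' B NB') as [I|I],
    (half_hom_assoc (y * a) b y A2 NA2 B NB') as [J|J].
  - apply Y2.
    assert (b * (y * y) * a = b * a) as F.
    { transitivity (b * y * (y * a)); [now grp_simpl|]. rewrite J.
      transitivity (y * (a * y * b)); [now grp_simpl|]. rewrite <- I.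
      rewrite <- K' at 2. now grp_simpl. }
    grp_from D F (b^-) (a^-).
  - apply NA'.
    assert (y * a * b = a * y * b) as F by (rewrite <- I, J; now grp_simpl).
    grp_from D F 1 (b^-).
  - apply NA'.
    assert (b * (y * y) * a = b * y^- * a * y^-) as F.
    { transitivity (b * y * (y * a)); [now grp_simpl|]. rewrite J.
      transitivity (y * a * (y * b)); [now grp_simpl|]. rewrite K.
      transitivity (y * (a * b) * y^-); [now grp_simpl|]. rewrite I.
      rewrite gmulA, K. reflexivity. }
    assert (y^- = y * y * y) as Y3.
    { symmetry. apply ginv_uniq. rewrite <- Y4. now grp_simpl. }
    assert (y^- * a = a * y^-) as F'.
    { rewrite Y3 at 1. grp_from D F (y * b^-) 1. }
    grp_from D F' y y.
  - apply NB'.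
    assert (y * b * a = b * y * a) as F by (rewrite gmulAr, <- I, gmulA, J; now grp_simpl).
    grp_from D F 1 (a^-).
Qed.

Lemma star_hom_or_antihom :
  (forall x y, x # y = x * y) \/ (forall x y, x # y = y * x).
Proof.
  (* The two alternatives describe the two subgroups used below: if the first is everything, [#] is
     the opposite law; if the second is, [#] is the given law. *)
  assert (forall y, (forall a, y # a = a * y) \/ (forall b, b # y = b * y)) as U.
  { intro y. destruct (classic (forall b, b # y = b * y)) as [R|N]; [now right|left].
    intro a. apply not_all_ex_not in N as [b N].
    destruct (half_hom_sides y a b); [assumption|contradiction]. }
  apply NNPP. intro N. apply not_or_and in N as [Np Nq].
  apply not_all_ex_not in Nq as [p Np']. apply not_all_ex_not in Np' as [c Np'].
  assert (exists q b, b # q <> b * q) as (q & b & Nq').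
  { apply not_all_ex_not in Np as [b Np]. apply not_all_ex_not in Np as [q Np]. now exists q, b. }
  destruct (U p) as [Lp|Rp]; [now apply Np'|].
  destruct (U q) as [Lq|Rq]; [|now apply Nq'].
  (* [p] and [q] lie in only one of two subgroups covering the group, so [p * q] lies in neither. *)
  destruct (U (p * q)) as [L|R].
  - apply Np'. pose proof (L c) as E.
    rewrite <- (Lq p), gmulAr, Lq, (Lq p) in E. grp_from D E 1 (q^-).
  - apply Nq'. assert (p^- # (p * q) = q) as E by (rewrite R; now grp_simpl).
    rewrite <- E at 1. rewrite gmulA, R, star_other by apply Rp. now grp_simpl.
Qed.
End NoMerging.

(** * Excluding involutions of the second law that are not involutions of the first *)

Section Merging.
Context (psi : G -> G).
Hypothesis psi_hom : forall x y, psi (x # y) = psi x * psi y.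
Hypothesis psi_inj : forall x y, psi x = psi y -> x = y.
Hypothesis psi_surj : forall y, exists x, psi x = y.

Lemma psi_one : psi 1 = 1.
Proof.
  apply (gmul_cancel_l D (psi 1)). now rewrite <- psi_hom, star_1l, gmul1r.
Qed.

Lemma star_invol_central u x y z :
  x # y <> x * y -> u # u = 1 -> z # u = u # z.
Proof.
  intros N U. apply psi_inj. rewrite !psi_hom. apply (invol_central _ _ x y N).
  now rewrite <- psi_hom, U, psi_one.
Qed.

Lemma no_merging u : u # u = 1 -> u * u = 1.
Proof.
  intro U. apply NNPP. intro N.
  (* The pair [u], [u] itself witnesses that the laws differ, since [u # u = 1 <> u * u]. *)
  assert (forall w z, w # w = 1 -> z # w = w # z) as cen.
  { intros w z W. apply (star_invol_central w u u z); congruence. }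
  assert (ginv S u = u) as UI by (symmetry; apply ginv_uniq; congruence).
  assert (forall y, (u # y) # (u # y) = y # y) as sq.
  { intro y. rewrite <- (cen u y U) at 1.
    now rewrite <- (gmulA _ S y u), (gmulA _ S u u), U, star_1l. }
  (* Neither [y] nor [u # y] is a [#]-involution, so both have the same inverse in the two laws. The
     four disjunctions come from [u # y], [y # u] and the inverses of [y^- # u] and [u # y^-], all
     equal because [u] is [#]-central. *)
  assert (forall y, y # y <> 1 ->
    (u # y = u * y \/ u # y = u * y^-) /\ (u # y = y * u \/ u # y = y * u^-) /\
    (u # y = y * u^- \/ u # y = y^- * u^-) /\ (u # y = u^- * y \/ u # y = u * y)) as cases.
  { intros y Y.
    assert (ginv S (u # y) = (u # y)^-) as I.
    { destruct (star_inv_cases (u # y)) as [E|E]; [exact E|]. now rewrite sq in E. }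
    assert (ginv S y = y^-) as Iy.
    { destruct (star_inv_cases y) as [E|E]; [exact E|contradiction]. }
    assert (u # y = (y^- # u)^-) as I1.
    { rewrite <- (ginvK D (u # y)), <- I, ginvM, UI, Iy. reflexivity. }
    assert (u # y = (u # y^-)^-) as I2 by (rewrite <- (cen u (y^-) U); exact I1).
    split; [apply star_dot|]. split; [rewrite <- (cen u y U); apply star_dot|]. split.
    - rewrite I2. destruct (star_dot u (y^-)) as [E|E]; rewrite E; grp_simpl; auto.
    - rewrite I1. destruct (star_dot (y^-) u) as [E|E]; rewrite E; grp_simpl; auto. }
  assert (forall y, u * y = y * u -> y # y = 1) as comm.
  { intros y C. apply NNPP. intro Y. destruct (cases y Y) as (C1 & _ & C3 & C4).
    assert (y * y <> 1) as Y' by (intro E; apply Y; now apply star_sq_invol).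
    assert ((u # y) * (u # y) <> 1) as Y2.
    { intro E. apply Y. rewrite <- sq. now apply star_sq_invol. }
    destruct C1 as [C1|C1]; rewrite C1 in *.
    - destruct C3 as [C3|C3].
      + apply N. rewrite C in C3. apply gmul_cancel_l in C3. rewrite C3 at 2. apply gmulVr.
      + apply Y2. rewrite C3 at 2. now grp_simpl.
    - destruct C4 as [C4|C4].
      + apply Y2. assert (u^- * y = y * u^-) as C' by grp_from D C (u^-) (u^-).
        rewrite C4 at 2. rewrite C'. now grp_simpl.
      + apply Y'. apply gmul_cancel_l in C4. rewrite <- C4 at 1. apply gmulV. }
  assert (forall y, y # y <> 1 -> u * y = y * u^-) as inverts.
  { intros y Y. destruct (cases y Y) as (C1 & C2 & _ & C4).
    assert (u * y <> y * u) as NC by (intro E; now apply Y, comm).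
    assert (y * y <> 1) as Y' by (intro E; apply Y; now apply star_sq_invol).
    destruct C1 as [C1|C1]; rewrite C1 in *.
    - destruct C2; [contradiction|assumption].
    - destruct C4 as [C4|C4].
      + destruct C2 as [C2|C2].
        * rewrite C4 in C2. grp_from D C2 u (u^-).
        * exfalso. apply NC. rewrite C4 in C2. grp_from D C2 u u.
      + exfalso. apply Y'. apply gmul_cancel_l in C4. rewrite <- C4 at 1. apply gmulV. }
  assert (forall x y, x # y = y # x) as ab.
  { intros x y. destruct (classic (x # x = 1)) as [X|X]; [symmetry; now apply cen|].
    destruct (classic (y # y = 1)) as [Y|Y]; [now apply cen|].
    pose proof (inverts x X) as Ix. pose proof (inverts y Y) as Iy.
    (* Two elements inverting [u] have a quotient commuting with [u]. Hence [y = x # c] for a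
       [#]-involution [c], which is [#]-central. *)
    assert (u * (x^- * y) = x^- * y * u) as C.
    { assert (u * x^- = x^- * u^-) as Ix' by grp_from D Ix (u * x^-) (x^- * u^-).
      assert (u^- * y = y * u) as Iy' by grp_from D Iy (u^-) u.
      now rewrite gmulA, Ix', gmulAr, Iy', gmulA. }
    assert (exists c, c # c = 1 /\ y = x # c) as (c & Cc & ->).
    { destruct (star_reach x (x^- * y)) as [E|E]; rewrite gmulK in E.
      - exists (x^- * y). split; [now apply comm|easy].
      - exists ((x^- * y)^-). split; [|easy].
        apply comm. grp_from D C ((x^- * y)^-) ((x^- * y)^-). }
    rewrite <- (gmulA _ S x c x), <- (cen c x Cc). reflexivity. }
  (* Through [psi], the law [*] is commutative too, so [comm] applies to the preimage [v] of [u],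
     and [u * u = psi (v # v) = 1]. *)
  apply N. destruct (psi_surj u) as [v E]. destruct (psi_surj v) as [t Et].
  rewrite <- E, <- psi_hom, comm; [apply psi_one|].
  now rewrite <- E, <- Et, <- !psi_hom, ab.
Qed.
End Merging.
End TwoLaws.

(** * Colour conditions as identities for the group law *)

Lemma colour_permuting_step (G : Type) (Gr : group_law G) (phi : G -> G) :
  colour_permuting Gr phi -> phi (gone Gr) = gone Gr ->
  forall x s, phi (gmul Gr x s) = gmul Gr (phi x) (phi s) \/
              phi (gmul Gr x s) = gmul Gr (phi x) (ginv Gr (phi s)).
Proof.
  intros [_ P] P1 x s.
  destruct (classic (s = gone Gr)) as [->|N].
  { left. now rewrite P1, !gmul1r. }
  (* The edges from 1 to [s] and from [x] to [x * s] share a colour, hence so do their images; [t]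
     is the quotient of the ends of the second image. *)
  destruct (P (gone Gr) s x (gmul Gr x s)) with (t := gmul Gr (ginv Gr (phi x)) (phi (gmul Gr x s)))
    as [_ E].
  - exists s. split; [exact N|now rewrite gmul1].
  - now exists s.
  - intro t. unfold colour. now grp_simpl.
  - destruct E as [E|E]; [now left| |]; rewrite P1 in E; grp_simpl_in E; rewrite <- E;
      rewrite gmulK; auto.
Qed.

(** The Cayley graph is complete: adjacency is just inequality. *)
Lemma graph_aut_bijective (G : Type) (Gr : group_law G) (f : G -> G) :
  bijective_map f -> graph_aut Gr f.
Proof.
  intros B. split; [exact B|]. destruct B as (g & gf & _).
  assert (forall x y, cay_adj Gr x y <-> x <> y) as A.
  { intros x y. split.
    - intros (s & N & ->) E. apply N. apply (gmul_cancel_l Gr x). now rewrite gmul1r.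
    - intro N. exists (gmul Gr (ginv Gr x) y). rewrite gmulK. split; [|easy].
      intro E. apply N. rewrite <- (gmulK Gr x y), E. symmetry. apply gmul1r. }
  intros x y. rewrite !A. split; intros N E; apply N; [|now rewrite E].
  now rewrite <- (gf x), E.
Qed.

Lemma colour_preserving_step (G : Type) (Gr : group_law G) (f : G -> G) :
  bijective_map f ->
  (forall x s, f (gmul Gr x s) = gmul Gr (f x) s \/
               f (gmul Gr x s) = gmul Gr (f x) (ginv Gr s)) ->
  colour_preserving Gr f.
Proof.
  intros B H. split; [now apply graph_aut_bijective|].
  intros g h (s & _ & ->) t. unfold colour.
  destruct (H g s) as [E|E]; rewrite E; grp_simpl; tauto.
Qed.

Lemma bijective_map_comp (G : Type) (f g : G -> G) :
  bijective_map f -> bijective_map g -> bijective_map (fun x => f (g x)).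
Proof.
  intros (f' & F1 & F2) (g' & K1 & K2). exists (fun x => g' (f' x)).
  split; intro x; congruence.
Qed.

Lemma bijective_mul_l (G : Type) (Gr : group_law G) (c : G) : bijective_map (gmul Gr c).
Proof.
  exists (gmul Gr (ginv Gr c)). split; intro x; [apply gmulKV|apply gmulK].
Qed.

(** The law that makes [f] an isomorphism from [Gr], with inverse [g]. *)
Definition transport_law {G : Type} (Gr : group_law G) (f g : G -> G)
  (gf : forall x, g (f x) = x) (fg : forall x, f (g x) = x) : group_law G.
Proof.
  refine {| gmul := fun x y => f (gmul Gr (g x) (g y)); gone := f (gone Gr);
            ginv := fun x => f (ginv Gr (g x)) |}.
  - intros x y z. now rewrite !gf, gmulA.
  - intro x. now rewrite gf, gmul1.
  - intro x. now rewrite gf, gmulV.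
Defined.

Lemma colour_permuting_hom_or_antihom (G : Type) (Gr : group_law G) (phi : G -> G) :
  colour_permuting Gr phi -> phi (gone Gr) = gone Gr ->
  (forall x y, phi (gmul Gr x y) = gmul Gr (phi x) (phi y)) \/
  (forall x y, phi (gmul Gr x y) = gmul Gr (phi y) (phi x)).
Proof.
  intros C P1. pose proof (colour_permuting_step G Gr phi C P1) as step.
  destruct C as [[(psi & gf & fg) _] _].
  set (S := transport_law Gr phi psi gf fg).
  assert (forall x y, gmul S x y = gmul Gr x y \/ gmul S x y = gmul Gr x (ginv Gr y)) as SD.
  { intros x y. cbn. destruct (step (psi x) (psi y)) as [E|E]; rewrite E, !fg; auto. }
  assert (forall x, gmul S x x = gone Gr -> gmul Gr x x = gone Gr) as NM.
  { apply (no_merging Gr S P1 SD psi).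
    - intros x y. cbn. now rewrite gf.
    - intros x y E. now rewrite <- (fg x), E.
    - intro y. now exists (phi y). }
  destruct (star_hom_or_antihom Gr S P1 SD NM) as [H|H]; [left|right]; intros x y;
    rewrite <- (H (phi x) (phi y)); cbn; now rewrite !gf.
Qed.

Lemma colour_permuting_mul_l (G : Type) (Gr : group_law G) (phi : G -> G) (c : G) :
  colour_permuting Gr phi -> colour_permuting Gr (fun x => gmul Gr c (phi x)).
Proof.
  intros [[B _] P]. split.
  - apply graph_aut_bijective.
    exact (bijective_map_comp G (gmul Gr c) phi (bijective_mul_l G Gr c) B).
  - intros g h g' h' A A' E t. specialize (P g h g' h' A A' E t).
    unfold colour in *. grp_simpl. exact P.
Qed.

Lemma bijective_inv (G : Type) (Gr : group_law G) : bijective_map (ginv Gr).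
Proof. exists (ginv Gr). split; apply ginvK. Qed.

Theorem theorem1p3 (G : Type) (Gr : group_law G) (phi : G -> G) :
  colour_permuting Gr phi ->
  exists alpha beta : G -> G,
    group_aut Gr alpha /\ colour_preserving Gr beta /\
    forall x, phi x = alpha (beta x).
Proof.
  intro C. set (c := phi (gone Gr)).
  set (f := fun x => gmul Gr (ginv Gr c) (phi x)).
  assert (colour_permuting Gr f) as Cf by now apply colour_permuting_mul_l.
  assert (f (gone Gr) = gone Gr) as f1 by apply gmulV.
  assert (bijective_map f) as Bf by apply Cf.
  assert (forall x, phi x = gmul Gr c (f x)) as phiE.
  { intro x. unfold f. now rewrite gmulK. }
  assert (forall x y, f x = f y -> x = y) as f_inj.
  { destruct Bf as (g & gf & _). intros x y E. now rewrite <- (gf x), E. }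
  destruct (colour_permuting_hom_or_antihom G Gr f Cf f1) as [H|H].
  (* Here [f] is an automorphism, and the translation by [c] is pulled through it as translation by
     [g c]. *)
  - destruct Bf as (g & gf & fg). exists f, (gmul Gr (g c)). split; [|split].
    + split; [now exists g|exact H].
    + apply colour_preserving_step; [apply bijective_mul_l|].
      intros x s. left. apply gmulA.
    + intro x. now rewrite H, fg.
  (* Composing the antihomomorphism [f] with inversion gives an automorphism; the spare inversion
     goes into the colour-preserving factor. *)
  - set (a := fun x => ginv Gr (f x)).
    assert (forall x y, a (gmul Gr x y) = gmul Gr (a x) (a y)) as Ha.
    { intros x y. unfold a. now rewrite H, ginvM. }
    assert (bijective_map a) as Ba.
    { exact (bijective_map_comp G (ginv Gr) f (bijective_inv G Gr) Bf). }
    assert (forall x, a (ginv Gr x) = f x) as aV.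
    { intro x. unfold a. symmetry. apply ginv_uniq. rewrite <- H, gmulVr. exact f1. }
    destruct (Ba) as (b & ba & ab).
    exists a, (fun x => gmul Gr (b c) (ginv Gr x)). split; [easy|split].
    + apply colour_preserving_step.
      { exact (bijective_map_comp G (gmul Gr (b c)) (ginv Gr)
          (bijective_mul_l G Gr (b c)) (bijective_inv G Gr)). }
      intros x s. rewrite !gmulAr, ginvM.
      (* Since [f] reverses products and is injective, the colour condition says that [x^-1]
         commutes with [s] or conjugates it to its inverse. So inversion preserves colours. *)
      destruct (colour_permuting_step G Gr f Cf f1 (ginv Gr x) s) as [E|E].
      * right. rewrite <- H in E. apply f_inj in E.
        f_equal. grp_from Gr E (ginv Gr s) (ginv Gr s).
      * left. rewrite <- (aV s) in E. unfold a in E. rewrite ginvK, <- H in E.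
        apply f_inj in E. now rewrite E.
    + intro x. now rewrite Ha, ab, aV.
Qed.
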